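(* Let $A\in\mathbb{R}^{n\times n}$, let $\mathcal{U}_0=\langle 0,G_0\rangle_Z\subset\mathbb{R}^n$ be a zonotope centered at the origin, let $0=t_0<t_1<t_2<\dots$ with $\Delta t_k=t_{k+1}-t_k$, and let $\eta_k$ be positive integers. The maximum Hausdorff distance at any time $t\in\tau_k=[t_k,t_{k+1}]$ between the exact particular solution $$\mathcal{P}^{\mathcal{U}}(t)=\Big\{\int_0^{t}e^{A(t-\theta)}u(\theta)\,\mathrm{d}\theta\ \Big|\ u(\theta)\in\mathcal{U}_0\Big\}$$ and the outer-approximation $\widehat{\mathcal{P}}^{\mathcal{U}}(t_{k+1})$ (which satisfies $\mathcal{P}^{\mathcal{U}}(t)\subseteq\widehat{\mathcal{P}}^{\mathcal{U}}(t_{k+1})$ for all $t\in\tau_k$) is bounded by $$\max_{t\in[t_k,t_{k+1}]}d_H\big(\mathcal{P}^{\mathcal{U}}(t),\widehat{\mathcal{P}}^{\mathcal{U}}(t_{k+1})\big)\le\varepsilon^{\mathcal{U}}_k+\Delta\varepsilon^{\mathcal{U},\tau}_k(\Delta t_k,\eta_k),\qquad\Delta\varepsilon^{\mathcal{U},\tau}_k(\Delta t_k,\eta_k):=\operatorname{err}\big(e^{At_k}\widehat{\mathcal{P}}^{\mathcal{U}}(\Delta t_k)\big),$$ where $\widehat{\mathcal{P}}^{\mathcal{U}}(\cdot)$ and $\varepsilon^{\mathcal{U}}_k$ are defined in the context.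
   Context: A zonotope is $\langle c,G\rangle_Z=\{c+\sum_iG_{(\cdot,i)}\alpha_i:\alpha_i\in[-1,1]\}$. $\oplus$ is the Minkowski sum. $d_H$ is the Hausdorff distance with respect to the Euclidean norm. $\operatorname{box}(\mathcal{S})$ is the tightest axis-aligned box containing $\mathcal{S}$, $\operatorname{rad}(\mathcal{S})$ the radius of the smallest ball centered at the origin containing $\mathcal{S}$, and $\operatorname{err}(\mathcal{S}):=\operatorname{rad}(\operatorname{box}(\mathcal{S}))$. Input signals $u(\cdot)$ are (measurable) functions of time with $u(\theta)\in\mathcal{U}_0$ for all $\theta$. With $|A|$ the entrywise absolute value, $E(\Delta t,\eta)=e^{|A|\Delta t}-\sum_{i=0}^{\eta}\frac{(|A|\Delta t)^i}{i!}$ and $\boldsymbol{\mathcal{E}}(\Delta t,\eta)=[-E(\Delta t,\eta),E(\Delta t,\eta)]$ (interval matrix). The product of $[-E,E]$ with a zonotope $\langle c,G\rangle_Z$ is evaluated by the outer-approximation $\langle0,\operatorname{diag}(E(|c|+\sum_j|G_{(\cdot,j)}|))\rangle_Z$. One-step outer-approximation: $\widehat{\mathcal{P}}^{\mathcal{U}}(\Delta t_k)=\bigoplus_{i=0}^{\eta_k}\frac{A^i\Delta t_k^{i+1}}{(i+1)!}\,\mathcal{U}_0\oplus\boldsymbol{\mathcal{E}}(\Delta t_k,\eta_k)\Delta t_k\,\mathcal{U}_0$. Recursion: $\widehat{\mathcal{P}}^{\mathcal{U}}(t_0)=\{0\}$, $\widehat{\mathcal{P}}^{\mathcal{U}}(t_{k+1})=\widehat{\mathcal{P}}^{\mathcal{U}}(t_k)\oplus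 e^{At_k}\widehat{\mathcal{P}}^{\mathcal{U}}(\Delta t_k)$. Accumulated error: $\varepsilon^{\mathcal{U}}_0=0$, $\varepsilon^{\mathcal{U}}_{k+1}=\varepsilon^{\mathcal{U}}_k+\Delta\varepsilon^{\mathcal{U}}_k(\Delta t_k,\eta_k)$ with, for $\tilde A_i=\frac{A^i\Delta t_k^{i+1}}{(i+1)!}$, $\Delta\varepsilon^{\mathcal{U}}_k(\Delta t_k,\eta_k)=\operatorname{err}\big(e^{At_k}((\sum_{i=1}^{\eta_k}\tilde A_i)\mathcal{U}_0\oplus\boldsymbol{\mathcal{E}}(\Delta t_k,\eta_k)\Delta t_k\mathcal{U}_0)\big)+\operatorname{err}\big(e^{At_k}(\bigoplus_{i=1}^{\eta_k}\tilde A_i\mathcal{U}_0\oplus\boldsymbol{\mathcal{E}}(\Delta t_k,\eta_k)\Delta t_k\mathcal{U}_0)\big)$. *)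

(* Defs.v *)
(* Vectors of R^n are columns 'cV[R]_n; `|x| on matrices is the max norm, hence
   the explicit Euclidean norm below.  Suprema and infima of sets of reals are
   taken in \bar R, where they always exist. *)
From HB Require Import structures.
From mathcomp Require Import all_boot all_order all_algebra.
From mathcomp Require Import all_classical all_reals all_analysis.

Set Implicit Arguments.
Unset Strict Implicit.
Unset Printing Implicit Defensive.

Import Order.TTheory GRing.Theory Num.Theory.
Import numFieldNormedType.Exports.

Local Open Scope classical_set_scope.
Local Open Scope ring_scope.

Section Sets.
Context {R : realType}.

Definition enorm n (x : 'cV[R]_n) : R := Num.sqrt (\sum_i x i 0 ^+ 2).

Definition hausdorff n (S T : set 'cV[R]_n) : \bar R :=
  maxe (ereal_sup [set ereal_inf [set (enorm (x - y))%:E | y in T] | x in S])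
       (ereal_sup [set ereal_inf [set (enorm (x - y))%:E | x in S] | y in T]).

Definition minkowski_sum n (S T : set 'cV[R]_n) : set 'cV[R]_n :=
  [set x + y | x in S & y in T].

Definition mximage n p (M : 'M[R]_(p, n)) (S : set 'cV[R]_n) : set 'cV[R]_p :=
  [set M *m x | x in S].

Definition zonotope n m (c : 'cV[R]_n) (G : 'M[R]_(n, m)) : set 'cV[R]_n :=
  [set c + G *m a | a in [set a : 'cV[R]_m | forall j, -1 <= a j 0 <= 1]].

Definition interval_box n (l u : 'cV[R]_n) : set 'cV[R]_n :=
  [set x | forall i, l i 0 <= x i 0 <= u i 0].

Definition box n (S : set 'cV[R]_n) : set 'cV[R]_n :=
  smallest [set B | exists l u, B = interval_box l u] S.

Definition rad n (S : set 'cV[R]_n) : \bar R :=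
  ereal_inf [set r%:E | r in
    [set r : R | 0 <= r /\ S `<=` [set x | enorm x <= r]]].

Definition err n (S : set 'cV[R]_n) : \bar R := rad (box S).

Definition absmx n m (M : 'M[R]_(n, m)) : 'M[R]_(n, m) :=
  map_mx (fun x => `|x|) M.

(* Outer approximation of the product of the interval matrix [-E, E] with the
   zonotope <c, G>; it depends on the representation (c, G), not only on the
   set zonotope c G. *)
Definition symintmx_mul_zonotope n m (E : 'M[R]_n) (c : 'cV[R]_n)
    (G : 'M[R]_(n, m)) : set 'cV[R]_n :=
  zonotope 0 (diag_mx (E *m (absmx c + \sum_j absmx (col j G)))^T).

End Sets.

Section MatrixExponential.
Context {R : realType}.

Definition expmx_coeff n (B : 'M[R]_n) (i : nat) : 'M[R]_n :=
  (i`!%:R)^-1 *: B ^+ i.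

Definition expmx n (B : 'M[R]_n) : 'M[R]_n := limn (series (expmx_coeff B)).

(* E(dt, eta) = e^(|A| dt) - sum_(i <= eta) (|A| dt)^i / i!, with |A| entrywise. *)
Definition exp_remainder n (A : 'M[R]_n) (dt : R) (eta : nat) : 'M[R]_n :=
  expmx (dt *: absmx A) -
  \sum_(0 <= i < eta.+1) expmx_coeff (dt *: absmx A) i.

End MatrixExponential.

Section Reachability.
Context {R : realType}.

(* A vector-valued input is measurable when all its coordinates are, and is
   integrated coordinatewise. *)
Definition particular_solution n (A : 'M[R]_n) (U : set 'cV[R]_n) (t : R) :
    set 'cV[R]_n :=
  [set x | exists u : R -> 'cV[R]_n,
    [/\ forall i, measurable_fun [set: R] (fun s => u s i 0),
        forall s, U (u s) &
        x = \col_i Rintegral lebesgue_measure `[0, t]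
              (fun s => (expmx ((t - s) *: A) *m u s) i 0)]].

Definition taylor_int n (A : 'M[R]_n) (dt : R) (i : nat) : 'M[R]_n :=
  (dt ^+ i.+1 / (i.+1)`!%:R) *: A ^+ i.

Context (n m : nat) (A : 'M[R]_n) (G0 : 'M[R]_(n, m)).
Let U0 : set 'cV[R]_n := zonotope 0 G0.

Definition remainder_set (dt : R) (eta : nat) : set 'cV[R]_n :=
  symintmx_mul_zonotope (dt *: exp_remainder A dt eta) 0 G0.

Definition step_approx (dt : R) (eta : nat) : set 'cV[R]_n :=
  minkowski_sum
    (\big[@minkowski_sum R n/[set 0]]_(0 <= i < eta.+1)
       mximage (taylor_int A dt i) U0)
    (remainder_set dt eta).

Context (t : nat -> R) (eta : nat -> nat).
Let dt k := t k.+1 - t k.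

Fixpoint reach_approx (k : nat) : set 'cV[R]_n :=
  if k is j.+1 then
    minkowski_sum (reach_approx j)
      (mximage (expmx (t j *: A)) (step_approx (dt j) (eta j)))
  else [set 0].

(* In the first term the matrices are summed before being applied to the input
   set, in the second one it is the image sets that are summed. *)
Definition step_error (k : nat) : \bar R :=
  (err (mximage (expmx (t k *: A))
     (minkowski_sum
        (mximage (\sum_(1 <= i < (eta k).+1) taylor_int A (dt k) i)%R U0)
        (remainder_set (dt k) (eta k)))) +
   err (mximage (expmx (t k *: A))
     (minkowski_sum
        (\big[@minkowski_sum R n/[set 0%R]]_(1 <= i < (eta k).+1)
           mximage (taylor_int A (dt k) i) U0)
        (remainder_set (dt k) (eta k)))))%E.

Fixpoint total_error (k : nat) : \bar R :=
  if k is j.+1 then (total_error j + step_error j)%E else 0%E.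

Definition interval_error (k : nat) : \bar R :=
  err (mximage (expmx (t k *: A)) (step_approx (dt k) (eta k))).

End Reachability.

(* Main.v *)
Require Import Defs.
From HB Require Import structures.
From mathcomp Require Import all_boot all_order all_algebra.
From mathcomp Require Import all_classical all_reals all_analysis.
From mathcomp Require Import measurable_realfun ring lra.

Set Implicit Arguments.
Unset Strict Implicit.
Unset Printing Implicit Defensive.

Import Order.TTheory GRing.Theory Num.Theory.
Import numFieldNormedType.Exports.

Local Open Scope classical_set_scope.
Local Open Scope ring_scope.

(** Let [P(s)] be the exact particular solution and [U] the zonotope of inputs.

    Where the maximum is attained. As [0] belongs to [U], any response can be
    delayed by a zero input, so [P(s)] grows with [s]
    ([particular_solution_mono]). All the sets [P(s)] of the interval lie in the
    same outer set, so their Hausdorff distance to it decreases with [s]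
    ([hausdorff_antimono]): the maximum is attained at the left end [t k].

    Recursion. Cutting an input at time [c] gives
    [P(b + c) = P(b) + e^(bA) P(c)] as Minkowski sums ([particular_solutionD]),
    which is the recursion that defines the outer approximations. Inclusion and
    error bound thus reduce to one step of length [dt].

    One step, inclusion. Expand the kernel [e^((dt-s)A)] to order [eta]
    ([response_expansion]). In the term of order [i] the matrix [A^i] meets an
    integral of the input with a nonnegative weight, which by convexity is the
    total weight times a point of [U] ([zonotope_mean]); the tail is dominated
    entrywise by the remainder of [e^(|A| dt)], so its contribution stays in the
    remainder box.

    One step, error. A point of the step set applies the Taylor matrices to
    unrelated points of [U]. Take the response to the constant input equal to
    the one of order 0. The terms of order 0 cancel, and what remains is the
    difference of a point of each of the two sets measured by [step_error]
    ([step_cover]).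

    At the left end, then, every point of [reach_approx] at [t k.+1] is a point
    within [total_error] of [P(t k)] ([reach_cover]) plus a point of the set
    measured by [interval_error]. *)

(** * Partial sums of the exponential series *)

Lemma sum_triangle (V : nmodType) (F : nat -> nat -> V) N :
  \sum_(0 <= k < N) \sum_(0 <= p < k.+1) F p (k - p)%N =
  \sum_(0 <= p < N) \sum_(0 <= q < N - p) F p q.
Proof.
elim: N => [|N IH]; first by rewrite !big_nil.
rewrite big_nat_recr//= IH [RHS]big_nat_recr//= [in RHS]subSnn big_nat1.
rewrite [X in _ + X]big_nat_recr//= subnn addrA; congr (_ + _).
rewrite -big_split/= big_nat [RHS]big_nat; apply: eq_bigr => p /andP[_ pN].
by rewrite subSn 1?ltnW// big_nat_recr.
Qed.

(** What separates a product of two partial sums from the partial sum of the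
    Cauchy product is the part of the square beyond its antidiagonal. *)
Lemma sum_square_triangle (V : zmodType) (F : nat -> nat -> V) N :
  \sum_(0 <= p < N) \sum_(0 <= q < N) F p q -
  \sum_(0 <= k < N) \sum_(0 <= p < k.+1) F p (k - p)%N =
  \sum_(0 <= p < N) \sum_(N - p <= q < N) F p q.
Proof.
rewrite sum_triangle -sumrB; apply: eq_bigr => p _.
by rewrite (@big_cat_nat _ _ _ (N - p)%N) ?leq_subr//= addrAC subrr add0r.
Qed.

(** The defect of the Cauchy product only adds up terms, so domination of the
    terms passes to it; this reduces the defect of the matrix exponential to
    that of the real one, which is known to vanish. *)
Lemma norm_square_triangle (R : realType) (F G : nat -> nat -> R) N :
  (forall p q, `|F p q| <= G p q) ->
  `|\sum_(0 <= p < N) \sum_(0 <= q < N) F p q -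
    \sum_(0 <= k < N) \sum_(0 <= p < k.+1) F p (k - p)%N| <=
  \sum_(0 <= p < N) \sum_(0 <= q < N) G p q -
    \sum_(0 <= k < N) \sum_(0 <= p < k.+1) G p (k - p)%N.
Proof.
move=> FG; rewrite !sum_square_triangle.
apply: le_trans (ler_norm_sum _ _ _) _; apply: ler_sum => p _.
by apply: le_trans (ler_norm_sum _ _ _) _; apply: ler_sum.
Qed.

Lemma exp_coeff_ge0 (R : realType) (x : R) k : 0 <= x -> 0 <= exp_coeff x k.
Proof. by move=> x0; rewrite /exp_coeff/= divr_ge0 ?exprn_ge0 ?ler0n. Qed.

Lemma norm_exp_coeff (R : realType) (x : R) k :
  `|exp_coeff x k| = exp_coeff `|x| k.
Proof. by rewrite /exp_coeff/= normrM normfV normrX (ger0_norm (ler0n _ _)). Qed.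

Lemma ler_exp_coeff (R : realType) (x y : R) k :
  0 <= x -> x <= y -> exp_coeff x k <= exp_coeff y k.
Proof.
move=> x0 xy; rewrite /exp_coeff/= ler_wpM2r ?invr_ge0//.
by rewrite lerXn2r// nnegrE (le_trans x0).
Qed.

Lemma exp_coeffD (R : realType) (x y : R) k :
  \sum_(0 <= p < k.+1) exp_coeff x p * exp_coeff y (k - p)%N =
  exp_coeff (x + y) k.
Proof.
rewrite /exp_coeff/= addrC exprDn big_mkord mulr_suml.
apply: eq_bigr => -[p/=]; rewrite ltnS => pk _.
have /(congr1 (fun n => n%:R : R)) := bin_fact pk; rewrite !natrM => <-.
have p0 : p`!%:R != 0 :> R by rewrite pnatr_eq0 -lt0n fact_gt0.
have q0 : (k - p)`!%:R != 0 :> R by rewrite pnatr_eq0 -lt0n fact_gt0.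
have b0 : 'C(k, p)%:R != 0 :> R by rewrite pnatr_eq0 -lt0n bin_gt0.
by rewrite -mulr_natr; field; rewrite b0 p0 q0.
Qed.

Lemma cvg_expR (R : realType) (x : R) : series (exp_coeff x) @ \oo --> expR x.
Proof. exact: is_cvg_series_exp_coeff. Qed.

(** * Entries of the matrix exponential *)

Lemma cvg_mx (R : realType) n m (F : nat -> 'M[R]_(n, m)) (L : 'M[R]_(n, m)) :
  (forall i j, (fun N => F N i j) @ \oo --> L i j) -> F @ \oo --> L.
Proof.
move=> FL S [P LP PS]; suff : \forall N \near \oo, forall i j, P i j (F N i j).
  by apply: filterS => N PN; apply: PS.
by apply: filter_forall => i; apply: filter_forall => j; exact: FL (LP i j).
Qed.

Lemma scalemx_exp (R : realType) n (a : R) (A : 'M[R]_n) k :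
  (a *: A) ^+ k = a ^+ k *: A ^+ k.
Proof.
elim: k => [|k IH]; first by rewrite !expr0 scale1r.
by rewrite !exprS IH -!mulmxE -scalemxAl -scalemxAr scalerA.
Qed.

Lemma expmx_coeffZ (R : realType) n (a : R) (A : 'M[R]_n) k :
  expmx_coeff (a *: A) k = exp_coeff a k *: A ^+ k.
Proof. by rewrite /expmx_coeff scalemx_exp scalerA mulrC. Qed.

(** Submultiplicative bound on all entries at once: it makes the real
    exponential series dominate every entry of the matrix one. *)
Definition mxnorm1 (R : realType) n (A : 'M[R]_n) : R := \sum_i \sum_j `|A i j|.

Lemma mxnorm1_ge0 (R : realType) n (A : 'M[R]_n) : 0 <= mxnorm1 A.
Proof. by apply: sumr_ge0 => i _; apply: sumr_ge0. Qed.

Lemma normr_mx_expr (R : realType) n (A : 'M[R]_n) k i j :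
  `|(A ^+ k) i j| <= mxnorm1 A ^+ k.
Proof.
elim: k i j => [|k IH] i j.
  by rewrite !expr0 mxE; case: (_ == _); rewrite ?normr1 ?normr0.
rewrite !exprS -mulmxE mxE; apply: le_trans (ler_norm_sum _ _ _) _.
rewrite (@le_trans _ _ (\sum_l `|A i l| * mxnorm1 A ^+ k))//.
  by apply: ler_sum => l _; rewrite normrM ler_wpM2l.
rewrite -mulr_suml ler_wpM2r ?exprn_ge0 ?mxnorm1_ge0// /mxnorm1.
rewrite [leRHS](bigD1 i)//= lerDl.
by apply: sumr_ge0 => l _; apply: sumr_ge0.
Qed.

Lemma normr_expmx_coeff (R : realType) n (a : R) (A : 'M[R]_n) k i j :
  `|expmx_coeff (a *: A) k i j| <= exp_coeff (`|a| * mxnorm1 A) k.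
Proof.
rewrite expmx_coeffZ mxE normrM norm_exp_coeff /exp_coeff/= exprMn [leRHS]mulrAC.
by rewrite ler_wpM2l ?normr_mx_expr// divr_ge0 ?exprn_ge0 ?ler0n.
Qed.

Lemma series_mxE (R : realType) n (B : nat -> 'M[R]_n) N i j :
  series B N i j = series (fun k => B k i j) N.
Proof. by rewrite /series/= summxE. Qed.

(** Absolute convergence of each entry gives convergence in the matrix
    topology, so the limit that defines the exponential is entrywise. *)
Lemma cvg_expmx (R : realType) n (A : 'M[R]_n) i j :
  series (fun k => expmx_coeff A k i j) @ \oo --> expmx A i j.
Proof.
have cv p q : cvgn (series (fun k => expmx_coeff A k p q)).
  apply: normed_cvg; apply: series_le_cvg (is_cvg_series_exp_coeff (mxnorm1 A)) => //.
  - by move=> k; exact: normr_ge0.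
  - by move=> k; apply: exp_coeff_ge0; exact: mxnorm1_ge0.
  - move=> k; have := normr_expmx_coeff 1 A k p q.
    by rewrite scale1r normr1 mul1r.
pose L := \matrix_(p, q) limn (series (fun k => expmx_coeff A k p q)).
suff -> : expmx A = L by rewrite mxE.
apply: cvg_lim; first exact: norm_hausdorff.
apply: cvg_mx => p q; rewrite mxE.
under eq_fun do rewrite series_mxE.
exact: cv.
Qed.

(** Serves twice: with no leading term removed it bounds the exponential, with
    the Taylor polynomial removed it bounds the remainder. *)
Lemma normr_lim_series_tail (R : realType) (f g : nat -> R) (a b : R) N :
  (forall k, `|f k| <= g k) ->
  series f @ \oo --> a -> series g @ \oo --> b ->
  `|a - \sum_(0 <= k < N) f k| <= b - \sum_(0 <= k < N) g k.
Proof.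
move=> fg fa gb.
have fa' : `|series f M - \sum_(0 <= k < N) f k| @[M --> \oo] -->
    `|a - \sum_(0 <= k < N) f k|.
  by apply: cvg_norm; apply: cvgB => //; exact: cvg_cst.
have gb' : series g M - \sum_(0 <= k < N) g k @[M --> \oo] -->
    b - \sum_(0 <= k < N) g k.
  by apply: cvgB => //; exact: cvg_cst.
apply: ler_cvg_to fa' gb' _.
exists N => // M /= NM.
rewrite /series/= !(@big_cat_nat _ _ _ N 0 M)//= [X in `|X|]addrAC subrr add0r.
rewrite [leRHS]addrAC subrr add0r.
by apply: le_trans (ler_norm_sum _ _ _) _; apply: ler_sum.
Qed.

Lemma normr_expmx (R : realType) n (a : R) (A : 'M[R]_n) i j :
  `|expmx (a *: A) i j| <= expR (`|a| * mxnorm1 A).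
Proof.
have := normr_lim_series_tail 0 (fun k => normr_expmx_coeff a A k i j)
  (@cvg_expmx R n (a *: A) i j) (@cvg_expR R (`|a| * mxnorm1 A)).
by rewrite !big_nil !subr0.
Qed.

Lemma normr_mx_expr_absmx (R : realType) n (A : 'M[R]_n) k i j :
  `|(A ^+ k) i j| <= (absmx A ^+ k) i j.
Proof.
elim: k i j => [|k IH] i j.
  by rewrite !expr0 mxE; case: (_ == _); rewrite ?normr1 ?normr0.
rewrite !exprS -!mulmxE !mxE; apply: le_trans (ler_norm_sum _ _ _) _.
by apply: ler_sum => l _; rewrite normrM mxE ler_wpM2l.
Qed.

(** The signed counterpart of [exp_remainder]. *)
Definition expmx_tail (R : realType) n (A : 'M[R]_n) eta : 'M[R]_n :=
  expmx A - \sum_(0 <= i < eta.+1) expmx_coeff A i.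

(** Taking absolute values inside every matrix product only increases the
    terms, and they increase with the time step: one remainder bounds the tails
    at all earlier times. *)
Lemma normr_expmx_tail (R : realType) n (A : 'M[R]_n) (a b : R) eta i j :
  `|a| <= b ->
  `|expmx_tail (a *: A) eta i j| <= exp_remainder A b eta i j.
Proof.
move=> ab; rewrite /expmx_tail /exp_remainder 2!mxE [leRHS]mxE [X in _ <= _ + X]mxE.
rewrite !summxE; apply: normr_lim_series_tail; [|exact: cvg_expmx..].
move=> k; rewrite !expmx_coeffZ 2!mxE normrM norm_exp_coeff.
by rewrite ler_pM// ?exp_coeff_ge0 ?ler_exp_coeff ?normr_mx_expr_absmx.
Qed.

(** The defect between the product of the partial sums and the partial sum for
    the added times is dominated entrywise by the same defect for the real
    exponential at [|s| c] and [|r| c], which tends to 0 by [expRD]. *)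
Lemma expmxD (R : realType) n (A : 'M[R]_n) (s r : R) :
  expmx ((s + r) *: A) = expmx (s *: A) *m expmx (r *: A).
Proof.
apply/matrixP => i j.
pose S a N : 'M[R]_n := series (expmx_coeff (a *: A)) N.
pose c := mxnorm1 A.
pose D N := (S s N *m S r N) i j - S (s + r) N i j.
have cvS a p q : S a N p q @[N --> \oo] --> expmx (a *: A) p q.
  by rewrite /S; under eq_fun do rewrite series_mxE; exact: cvg_expmx.
have cvD : D N @[N --> \oo] -->
    (expmx (s *: A) *m expmx (r *: A)) i j - expmx ((s + r) *: A) i j.
  apply: cvgB; last exact: cvS.
  rewrite mxE; under eq_fun do rewrite mxE.
  apply: cvg_big => [|l _]; first exact: add_continuous.
  by apply: cvgM; exact: cvS.
pose E N : R := series (exp_coeff (`|s| * c)) N * series (exp_coeff (`|r| * c)) N -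
  series (exp_coeff (`|s| * c + `|r| * c)) N.
have cvE : E N @[N --> \oo] --> (0 : R).
  rewrite -(subrr (expR (`|s| * c + `|r| * c))) {1}expRD.
  by apply: cvgB; [apply: cvgM|]; exact: cvg_expR.
have DE N : `|D N| <= E N.
  pose F p q := (expmx_coeff (s *: A) p *m expmx_coeff (r *: A) q) i j.
  pose G p q := exp_coeff (`|s| * c) p * exp_coeff (`|r| * c) q.
  have -> : D N = \sum_(0 <= p < N) \sum_(0 <= q < N) F p q -
      \sum_(0 <= k < N) \sum_(0 <= p < k.+1) F p (k - p)%N.
    congr (_ - _).
      rewrite /S /series/= mulmx_suml summxE; apply: eq_bigr => p _.
      by rewrite mulmx_sumr summxE.
    rewrite /S /series/= summxE; apply: eq_bigr => k _.
    rewrite expmx_coeffZ -exp_coeffD mxE mulr_suml.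
    apply: eq_big_nat => p /andP[_ pk].
    rewrite /F !expmx_coeffZ -scalemxAl -scalemxAr scalerA mulmxE -exprD.
    by rewrite subnKC// mxE.
  have -> : E N = \sum_(0 <= p < N) \sum_(0 <= q < N) G p q -
      \sum_(0 <= k < N) \sum_(0 <= p < k.+1) G p (k - p)%N.
    rewrite /E /series/= mulr_suml; congr (_ - _).
      by apply: eq_bigr => p _; rewrite mulr_sumr.
    by apply: eq_bigr => k _; rewrite exp_coeffD.
  apply: norm_square_triangle => p q.
  rewrite /F /G !expmx_coeffZ -scalemxAl -scalemxAr scalerA mulmxE -exprD mxE.
  rewrite 2!normrM !norm_exp_coeff /exp_coeff/= !exprMn.
  rewrite (_ : _ * c ^+ p / _ * _ =
      (`|s| ^+ p / p`!%:R * (`|r| ^+ q / q`!%:R)) * c ^+ (p + q)); last first.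
    by rewrite exprD; ring.
  by rewrite ler_wpM2l ?normr_mx_expr// mulr_ge0 ?divr_ge0 ?exprn_ge0 ?ler0n.
apply/esym/eqP; rewrite -subr_eq0 -normr_le0.
apply: (ler_cvg_to (f := fun N => `|D N|) _ cvE); first exact: cvg_norm cvD.
by exists 0%N => // N _; exact: DE.
Qed.

(** A pointwise limit of polynomials in [h]. *)
Lemma measurable_expmx (R : realType) n (A : 'M[R]_n) (h : R -> R) i j :
  measurable_fun setT h ->
  measurable_fun [set: R] (fun s => expmx (h s *: A) i j).
Proof.
move=> mh.
pose F N (s : R) := series (fun k => expmx_coeff (h s *: A) k i j) N.
apply: (measurable_fun_cvg (h := F)); last by move=> s _; exact: cvg_expmx.
move=> N; rewrite /F /series/=; apply: measurable_sum => k.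
under eq_fun do rewrite expmx_coeffZ mxE /exp_coeff/=.
by apply: measurable_funM => //; apply: measurable_funM => //; exact: measurable_funX.
Qed.
(** * Integrals over segments *)

Section Integration.
Context {R : realType}.
Notation mu := (@lebesgue_measure R).
Implicit Types (f g : R -> R) (a b c : R).

Local Notation shift c := ((fun s => s + c)%R : measurableTypeR R -> measurableTypeR R).

(** Inputs are bounded but the kernels are bounded on segments only, hence a
    bound relative to [D]; the class is stable under sums and products, and its
    members are integrable on segments. *)
Definition bmeas (D : set R) (f : R -> R) : Prop :=
  measurable_fun [set: R] f /\ exists M, forall s, D s -> `|f s| <= M.

Lemma bmeas_cst D c : bmeas D (fun=> c).
Proof. by split; [exact: measurable_cst|exists `|c|]. Qed.

Lemma bmeasD D f g : bmeas D f -> bmeas D g -> bmeas D (fun s => f s + g s).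
Proof.
move=> [mf [M fM]] [mg [N gN]]; split; first exact: measurable_funD.
exists (M + N) => s Ds; apply: le_trans (ler_normD _ _) _.
by rewrite lerD ?fM ?gN.
Qed.

Lemma bmeasM D f g : bmeas D f -> bmeas D g -> bmeas D (fun s => f s * g s).
Proof.
move=> [mf [M fM]] [mg [N gN]]; split; first exact: measurable_funM.
by exists (M * N) => s Ds; rewrite normrM ler_pM ?fM ?gN.
Qed.

Lemma bmeas_sum D (I : Type) (r : seq I) (F : I -> R -> R) :
  (forall i, bmeas D (F i)) -> bmeas D (fun s => \sum_(i <- r) F i s).
Proof.
move=> bF; elim: r => [|i r IH].
  by under eq_fun do rewrite big_nil; exact: bmeas_cst.
by under eq_fun do rewrite big_cons; exact: bmeasD.
Qed.

Lemma bmeasW D E f : E `<=` D -> bmeas D f -> bmeas E f.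
Proof. by move=> ED [mf [M fM]]; split => //; exists M => s /ED /fM. Qed.

Lemma bmeas_integrable a b f :
  bmeas `[a, b] f -> mu.-integrable `[a, b] (EFin \o f).
Proof.
move=> [mf [M fM]]; apply: measurable_bounded_integrable => //.
- by rewrite /= lebesgue_measure_itv/=; case: ifP => // _; rewrite -EFinB ltry.
- exact: measurable_funTS.
- exists M; split; first exact: num_real.
  by move=> x Mx s /fM /le_trans; apply; exact: ltW.
Qed.

(** Translation preserves the length of the intervals that generate the
    measure. *)
Lemma lebesgue_measure_shift c (A : set R) : measurable A ->
  pushforward mu (shift c) A = mu A.
Proof.
move=> mA.
have ms : measurable_fun [set: measurableTypeR R]
    (shift c).
  exact: measurable_funD.
pose H := isMeasurableFun.Build _ _ _ _ _ ms.
pose phi : {mfun measurableTypeR R >-> measurableTypeR R} :=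
  HB.pack (shift c) H.
apply/esym; have /= := @lebesgue_measure_unique R (pushforward mu phi); apply => //.
move=> _ [[a b]] _ <-.
rewrite /pushforward/= (_ : _ @^-1` _ = `]a - c, b - c]%classic); last first.
  by apply/seteqP; split=> s/=; rewrite !in_itv/= ltrBlDr lerBrDr.
rewrite !lebesgue_measure_itv/= !lte_fin ltrD2r.
by case: ifP => // _; rewrite -!EFinB opprB addrA subrK.
Qed.

(** The inputs are merely measurable, so the substitution goes through the
    image measure instead of the fundamental theorem of calculus. *)
Lemma Rintegral_shift b c f : bmeas `[c, b + c] f ->
  \int[mu]_(s in `[c, b + c]) f s = \int[mu]_(s in `[0, b]) f (s + c).
Proof.
move=> bf; rewrite /Rintegral; congr fine.
have preE : ((fun s : R => s + c) @^-1` `[c, b + c])%classic = `[0, b]%classic.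
  by apply/seteqP; split=> s/=; rewrite !in_itv/= lerD2r lerDr.
have ms : measurable_fun [set: measurableTypeR R]
    (shift c).
  exact: measurable_funD.
have [mf [M fM]] := bf.
rewrite -preE.
transitivity (\int[pushforward mu (shift c)]_(s in `[c, (b + c)%R]) (f s)%:E)%E.
  by apply: eq_measure_integral => A mA _; rewrite -[LHS](lebesgue_measure_shift c).
rewrite integral_pushforward//; first exact/measurable_EFinP.
rewrite preE; apply: (@bmeas_integrable 0 b (fun s => f (s + c))); split.
  exact: (measurableT_comp mf ms).
by exists M => s sb; apply: fM; have : (`[0, b]%classic : set R) s by []; rewrite -preE.
Qed.

Lemma Rintegral_split a b c f : a <= c <= b -> bmeas `[a, b] f ->
  \int[mu]_(s in `[a, b]) f s =
  \int[mu]_(s in `[a, c]) f s + \int[mu]_(s in `[c, b]) f s.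
Proof.
move=> /andP[ac cb] bf.
have bfcb : bmeas `[c, b] f.
  by apply: bmeasW bf => s/=; rewrite !in_itv/= => /andP[/(le_trans ac) -> ->].
rewrite -[X in _ + X]Rintegral_itv_obnd_cbnd; last first.
  apply: integrableS (bmeas_integrable bfcb) => //.
  by apply: subset_itvr; rewrite bnd_simp.
rewrite -(@Rintegral_itvB _ _ (BLeft a) (BRight b) c) ?bnd_simp//.
  by rewrite addrCA subrr addr0.
exact: bmeas_integrable.
Qed.

Lemma Rintegral_sum a b (I : Type) (r : seq I) (F : I -> R -> R) :
  (forall i, bmeas `[a, b] (F i)) ->
  \int[mu]_(s in `[a, b]) (\sum_(i <- r) F i s) =
  \sum_(i <- r) \int[mu]_(s in `[a, b]) F i s.
Proof.
move=> bF; elim: r => [|i r IH].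
  under eq_Rintegral do rewrite big_nil.
  by rewrite big_nil Rintegral_cst// mul0r.
under eq_Rintegral do rewrite big_cons.
rewrite big_cons RintegralD//; [|exact: bmeas_integrable|].
  by congr (_ + _).
by apply: bmeas_integrable; exact: bmeas_sum.
Qed.

Lemma normr_Rintegral_le b M f : 0 <= b -> bmeas `[0, b] f ->
  (forall s, 0 <= s <= b -> `|f s| <= M) ->
  `|\int[mu]_(s in `[0, b]) f s| <= b * M.
Proof.
move=> b0 bf fM; have iF := bmeas_integrable bf.
apply: le_trans (le_normr_Rintegral _ iF) _ => //.
apply: (@le_trans _ _ (\int[mu]_(s in `[0, b]) M)).
  have iM : mu.-integrable `[0, b] (EFin \o cst M).
    exact: (bmeas_integrable (@bmeas_cst _ M)).
  apply: (le_Rintegral _ (integrable_norm iF) iM) => //.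
rewrite Rintegral_cst//= lebesgue_measure_itv/= lte_fin.
case: ltP => [_|b0']; first by rewrite -EFinB/= subr0 mulrC.
by rewrite /= (@le_anti _ _ b 0) ?b0 ?b0'// mul0r mulr0.
Qed.

Lemma Rintegral_exp_coeff b k : 0 < b ->
  \int[mu]_(s in `[0, b]) (exp_coeff (b - s) k) = exp_coeff b k.+1.
Proof.
move=> b0; pose F (s : R) := - exp_coeff (b - s) k.+1.
have dF (s : R) : is_derive s (1 : R) F (exp_coeff (b - s) k).
  have k0 : k`!%:R != 0 :> R by rewrite pnatr_eq0 -lt0n fact_gt0.
  have k1 : k.+1%:R != 0 :> R by rewrite pnatr_eq0.
  rewrite (_ : F = (- (k.+1)`!%:R^-1 : R) \*: ((cst b - id) ^+ k.+1 : R -> R)); last first.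
    apply/funext => r; rewrite /F /exp_coeff/= exprfctE !fctE/=.
    by rewrite scaleNr /GRing.scale/= mulrC.
  apply: is_derive_eq; rewrite /exp_coeff/= sub0r !fctE/= /GRing.scale/= factS natrM.
  by field; rewrite k0 addrC natr1 k1.
have cF (s : R) : {for s, continuous F}.
  by apply: differentiable_continuous; apply/derivable1_diffP; have [] := dF s.
rewrite /Rintegral (@continuous_FTC2 _ _ F)//=.
- rewrite /F subr0 subrr opprK {1}/exp_coeff/= expr0n/= mul0r.
  by rewrite oppr0 add0r.
- apply: continuous_subspaceT => s.
  rewrite /exp_coeff/=; apply: cvgM; last exact: cvg_cst.
  apply: (@continuous_comp _ _ _ (fun s => b - s) (fun x => x ^+ k)).
    by apply: (@cvgB _ R^o); [exact: cvg_cst|exact: cvg_id].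
  exact: exprn_continuous.
- split.
  + by move=> s _; have [] := dF s.
  + by apply: cvg_at_right_filter; exact: cF.
  + by apply: cvg_at_left_filter; exact: cF.
- by move=> s _; rewrite derive1E; have [_] := dF s.
Qed.

End Integration.
(** * Euclidean geometry *)

Section Euclidean.
Context {R : realType}.

Definition dotv n (x y : 'cV[R]_n) : R := \sum_i x i 0 * y i 0.

Lemma dotvC n (x y : 'cV[R]_n) : dotv x y = dotv y x.
Proof. by apply: eq_bigr => i _; rewrite mulrC. Qed.

Lemma dotvDl n (x y z : 'cV[R]_n) : dotv (x + y) z = dotv x z + dotv y z.
Proof. by rewrite /dotv -big_split; apply: eq_bigr => i _; rewrite mxE mulrDl. Qed.

Lemma dotvZl n (a : R) (x y : 'cV[R]_n) : dotv (a *: x) y = a * dotv x y.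
Proof. by rewrite /dotv mulr_sumr; apply: eq_bigr => i _; rewrite mxE mulrA. Qed.

Lemma dotvDr n (x y z : 'cV[R]_n) : dotv x (y + z) = dotv x y + dotv x z.
Proof. by rewrite dotvC dotvDl !(dotvC _ x). Qed.

Lemma dotvZr n (a : R) (x y : 'cV[R]_n) : dotv x (a *: y) = a * dotv x y.
Proof. by rewrite dotvC dotvZl dotvC. Qed.

Lemma dotvv_ge0 n (x : 'cV[R]_n) : 0 <= dotv x x.
Proof. by apply: sumr_ge0 => i _; rewrite -expr2 sqr_ge0. Qed.

Lemma dotvv_eq0 n (x : 'cV[R]_n) : dotv x x <= 0 -> x = 0.
Proof.
move=> x0; have /eqP : dotv x x = 0 by apply/le_anti; rewrite x0 dotvv_ge0.
rewrite psumr_eq0 => [/allP x_eq0|i _]; last by rewrite -expr2 sqr_ge0.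
apply/colP => i; rewrite mxE; apply/eqP.
by have := x_eq0 i (mem_index_enum i); rewrite /= mulf_eq0 orbb.
Qed.

Lemma enormE n (x : 'cV[R]_n) : enorm x = Num.sqrt (dotv x x).
Proof. by []. Qed.

Lemma enorm_ge0 n (x : 'cV[R]_n) : 0 <= enorm x.
Proof. exact: sqrtr_ge0. Qed.

Lemma enorm_sqr n (x : 'cV[R]_n) : enorm x ^+ 2 = dotv x x.
Proof. by rewrite enormE sqr_sqrtr// dotvv_ge0. Qed.

Lemma enorm0 n : enorm (0 : 'cV[R]_n) = 0.
Proof. by rewrite enormE /dotv big1 ?sqrtr0// => i _; rewrite mxE mul0r. Qed.

Lemma enormN n (x : 'cV[R]_n) : enorm (- x) = enorm x.
Proof.
by rewrite !enormE -[in LHS]scaleN1r dotvZl dotvZr mulrA mulrNN !mul1r.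
Qed.

(** Expands the square of [dotv y y *: x - dotv x y *: y]. *)
Lemma cauchy_schwarz n (x y : 'cV[R]_n) : dotv x y <= enorm x * enorm y.
Proof.
have [y0|] := leP (dotv y y) 0.
  rewrite (dotvv_eq0 y0) enorm0 mulr0.
  by rewrite /dotv big1// => i _; rewrite mxE mulr0.
move=> y0; have := dotvv_ge0 (dotv y y *: x + (- dotv x y) *: y).
rewrite !(dotvDl, dotvDr, dotvZl, dotvZr) (dotvC y x).
set X := dotv x x; set Y := dotv y y; set D := dotv x y => H.
have {}H : D ^+ 2 <= X * Y.
  rewrite -(ler_pM2l y0) -/Y -subr_ge0; apply: le_trans H _.
  by rewrite le_eqVlt; apply/orP; left; apply/eqP; ring.
rewrite (le_trans (ler_norm _))// -(@ler_pXn2r _ 2) ?nnegrE ?mulr_ge0 ?enorm_ge0//.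
by rewrite exprMn !enorm_sqr real_normK ?num_real.
Qed.

Lemma enormD n (x y : 'cV[R]_n) : enorm (x + y) <= enorm x + enorm y.
Proof.
rewrite -(@ler_pXn2r _ 2) ?nnegrE ?addr_ge0 ?enorm_ge0//.
rewrite enorm_sqr sqrrD !enorm_sqr dotvDl !dotvDr (dotvC y x).
have := cauchy_schwarz x y; lra.
Qed.

(** * Zonotopes *)

Lemma zonotope0_0 n m (G : 'M[R]_(n, m)) : zonotope 0 G 0.
Proof.
exists 0; last by rewrite mulmx0 addr0.
by move=> j; rewrite mxE lerN10 ler01.
Qed.

Lemma zonotope_convex n m (c : 'cV[R]_n) (G : 'M[R]_(n, m)) x y (l : R) :
  zonotope c G x -> zonotope c G y -> 0 <= l <= 1 ->
  zonotope c G (x + l *: (y - x)).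
Proof.
move=> [a /= ha <-] [b /= hb <-] /andP[l0 l1].
exists (a + l *: (b - a)).
  by move=> j /=; rewrite !mxE; move: (ha j) (hb j) => /andP[? ?] /andP[? ?]; nra.
by rewrite mulmxDr -scalemxAr mulmxBr addrA opprD addrACA subrr add0r.
Qed.

Lemma zonotope0_bound n m (G : 'M[R]_(n, m)) x i :
  zonotope 0 G x -> `|x i 0| <= \sum_j `|G i j|.
Proof.
move=> [a /= ha <-]; rewrite add0r mxE.
apply: le_trans (ler_norm_sum _ _ _) _; apply: ler_sum => j _.
by rewrite normrM ler_piMr// ler_norml ha.
Qed.

(** A zonotope is the continuous image of a compact cube. *)
Lemma zonotope_nearest n m (c : 'cV[R]_n) (G : 'M[R]_(n, m)) x :
  exists2 p, zonotope c G p &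
    forall y, zonotope c G y -> dotv (x - p) (x - p) <= dotv (x - y) (x - y).
Proof.
pose A := [set a : 'rV[R]_m | forall j, (`[-1, 1]%classic : set R) (a ord0 j)].
pose f (a : 'rV[R]_m) := dotv (x - (c + G *m a^T)) (x - (c + G *m a^T)).
have cA : compact A.
  apply: (@rV_compact R m (fun=> `[-1, 1]%classic)) => _.
  exact: segment_compact.
have A0 : A !=set0.
  by exists 0 => j/=; rewrite in_itv/= mxE lerN10 ler01.
have cg i : continuous (fun a : 'rV[R]_m => (x - (c + G *m a^T)) i 0).
  rewrite (_ : (fun _ => _) =
      fun a : 'rV[R]_m => x i 0 - (c i 0 + \sum_j G i j * a ord0 j)); last first.
    by apply/funext => b; rewrite !mxE; under eq_bigr do rewrite mxE.
  move=> a; apply: (@cvgB _ R^o _ (nbhs a)); first exact: cvg_cst.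
  apply: (@cvgD _ R^o _ (nbhs a)); first exact: cvg_cst.
  apply: (@cvg_big _ _ _ _ _ _ _ (nbhs a)) => [|j _]; first exact: add_continuous.
  apply: (@cvgM _ _ (nbhs a)); first exact: cvg_cst.
  exact: coord_continuous.
have cf : {within A, continuous f}.
  apply: continuous_subspaceT => a.
  apply: (@cvg_big _ _ _ _ _ _ _ (nbhs a)) => [|i _]; first exact: add_continuous.
  by apply: (@cvgM _ _ (nbhs a)); exact: cg.
have [a /[!inE] Aa fa] := EVT_min_rV A0 cA cf.
exists (c + G *m a^T).
  by exists a^T => // j /=; have := Aa j; rewrite /= in_itv/= mxE.
move=> _ [b /= hb <-]; have := fa b^T; rewrite /f trmxK; apply.
by rewrite inE => j; rewrite /= in_itv/= mxE hb.
Qed.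

(** The nearest point [p] separates: moving from [p] towards [y] cannot bring
    one closer to [x]. *)
Lemma zonotope_projection n m (c : 'cV[R]_n) (G : 'M[R]_(n, m)) x :
  exists2 p, zonotope c G p & forall y, zonotope c G y -> dotv (x - p) (y - p) <= 0.
Proof.
have [p Zp p_min] := zonotope_nearest c G x.
exists p => // y Zy; rewrite leNgt; apply/negP => d0.
set d := dotv _ _ in d0; pose q := dotv (y - p) (y - p).
have q0 : 0 <= q by exact: dotvv_ge0.
have dq : 0 < d + q by rewrite ltr_pwDl.
(* The minimizer [d / q] along the line may lie beyond [y]; this shorter step
   still decreases the distance to [x]. *)
pose l := d / (d + q).
have l01 : 0 <= l <= 1.
  by rewrite /l divr_ge0 ?(ltW d0) ?(ltW dq)//= ler_pdivrMr// mul1r lerDl.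
have := p_min _ (zonotope_convex Zp Zy l01).
have expand (e g : 'cV[R]_n) : dotv (e - l *: g) (e - l *: g) =
    dotv e e - 2 * l * dotv e g + l * l * dotv g g.
  by rewrite -scaleNr !(dotvDl, dotvDr, dotvZl, dotvZr) (dotvC g e); ring.
rewrite opprD addrA expand -/d -/q => H.
have : 2 * d <= l * q.
  have l0 : 0 < l by rewrite divr_gt0.
  by rewrite -(ler_pM2l l0); lra.
rewrite /l mulrAC ler_pdivlMr//; nra.
Qed.

End Euclidean.
(** * Integrals of vector-valued inputs *)

Section Inputs.
Context {R : realType}.
Notation mu := (@lebesgue_measure R).
Implicit Types (a b c : R).

Lemma bmeasBid c a b : bmeas `[a, b] (fun s : R => c - s).
Proof.
split; first exact: measurable_funB.
exists (`|c| + (`|a| + `|b|)) => s /=; rewrite in_itv/= => /andP[sa sb].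
apply: le_trans (ler_normB _ _) _; rewrite lerD2l.
have := ler_norm b; have := ler_norm (- a); rewrite normrN.
rewrite ler_norml => *.
by apply/andP; split; have := normr_ge0 a; have := normr_ge0 b; lra.
Qed.

Lemma bmeasX (D : set R) (f : R -> R) k : bmeas D f -> bmeas D (fun s => f s ^+ k).
Proof.
move=> bf; elim: k => [|k IH].
  by under eq_fun do rewrite expr0; exact: bmeas_cst.
by under eq_fun do rewrite exprS; exact: bmeasM.
Qed.

Lemma bmeas_exp_coeff a b c k : bmeas `[a, b] (fun s : R => exp_coeff (c - s) k).
Proof. by apply: bmeasM (bmeas_cst _ _); apply: bmeasX; exact: bmeasBid. Qed.

Lemma bmeas_expmx n (A : 'M[R]_n) a b c i j :
  bmeas `[a, b] (fun s => expmx ((c - s) *: A) i j).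
Proof.
have [mh [M hM]] := bmeasBid c a b.
split; first exact: measurable_expmx.
exists (expR (M * mxnorm1 A)) => s /hM sM.
by apply: le_trans (normr_expmx _ _ _ _) _; rewrite ler_expR ler_wpM2r ?mxnorm1_ge0.
Qed.

Lemma bmeas_expmx_tail n (A : 'M[R]_n) eta a b c i j :
  bmeas `[a, b] (fun s => expmx_tail ((c - s) *: A) eta i j).
Proof.
rewrite /expmx_tail.
rewrite (_ : (fun _ => _) = fun s => expmx ((c - s) *: A) i j +
    (-1) * \sum_(0 <= k < eta.+1) exp_coeff (c - s) k * (A ^+ k) i j).
  apply: bmeasD; first exact: bmeas_expmx.
  apply: bmeasM; first exact: bmeas_cst.
  apply: bmeas_sum => k; apply: bmeasM (bmeas_cst _ _); exact: bmeas_exp_coeff.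
apply/funext => s; rewrite !mxE summxE mulN1r; congr (_ - _).
by apply: eq_bigr => k _; rewrite expmx_coeffZ mxE.
Qed.

Lemma bmeas_mulmx (D : set R) n p (K : R -> 'M[R]_(p, n)) (v : R -> 'cV[R]_n) :
  (forall i j, bmeas D (fun s => K s i j)) ->
  (forall j, bmeas D (fun s => v s j 0)) ->
  forall i, bmeas D (fun s => (K s *m v s) i 0).
Proof.
move=> bK bv i; under eq_fun do rewrite mxE.
by apply: bmeas_sum => j; exact: bmeasM.
Qed.

Definition vint n b (f : R -> 'cV[R]_n) : 'cV[R]_n :=
  \col_i \int[mu]_(s in `[0, b]) f s i 0.

Lemma eq_vint n b (f g : R -> 'cV[R]_n) :
  (forall s, 0 <= s <= b -> f s = g s) -> vint b f = vint b g.
Proof.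
move=> fg; apply/colP => i; rewrite !mxE; apply: eq_Rintegral => s.
by rewrite inE/= in_itv/= => /fg ->.
Qed.

(** At the junction time a concatenation takes the value of the earlier input,
    so it agrees with the later one on a half-open interval only. *)
Lemma eq_vint_oc n b (f g : R -> 'cV[R]_n) :
  (forall i, bmeas `[0, b] (fun s => f s i 0)) ->
  (forall i, bmeas `[0, b] (fun s => g s i 0)) ->
  (forall s, 0 < s <= b -> f s = g s) -> vint b f = vint b g.
Proof.
move=> bf bg fg; apply/colP => i; rewrite !mxE.
have sub : `]0, b] `<=` (`[0, b] : set R).
  by move=> s/=; rewrite !in_itv/= => /andP[/ltW -> ->].
have iI h : bmeas `[0, b] h -> mu.-integrable `]0, b] (EFin \o h).
  by move=> bh; apply: integrableS (bmeas_integrable bh).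
rewrite -Rintegral_itv_obnd_cbnd; last exact: (iI _ (bf i)).
rewrite -[RHS]Rintegral_itv_obnd_cbnd; last exact: (iI _ (bg i)).
by apply: eq_Rintegral => s; rewrite inE/= in_itv/= => /fg ->.
Qed.

Lemma vint_mulmx n p b (M : 'M[R]_(p, n)) (f : R -> 'cV[R]_n) :
  (forall i, bmeas `[0, b] (fun s => f s i 0)) ->
  M *m vint b f = vint b (fun s => M *m f s).
Proof.
move=> bf; apply/colP => i; rewrite !mxE.
under [RHS]eq_Rintegral do rewrite mxE.
rewrite Rintegral_sum; last by move=> j; apply: bmeasM => //; exact: bmeas_cst.
apply: eq_bigr => j _; rewrite mxE RintegralZl//; exact: bmeas_integrable.
Qed.

Lemma vintD n b (f g : R -> 'cV[R]_n) :
  (forall i, bmeas `[0, b] (fun s => f s i 0)) ->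
  (forall i, bmeas `[0, b] (fun s => g s i 0)) ->
  vint b (fun s => f s + g s) = vint b f + vint b g.
Proof.
move=> bf bg; apply/colP => i; rewrite !mxE.
under eq_Rintegral do rewrite mxE.
by rewrite RintegralD//; exact: bmeas_integrable.
Qed.

Lemma bmeas_vsum (D : set R) n (r : seq nat) (f : nat -> R -> 'cV[R]_n) :
  (forall k i, bmeas D (fun s => f k s i 0)) ->
  forall i, bmeas D (fun s => (\sum_(k <- r) f k s) i 0).
Proof.
move=> bf i; under eq_fun do rewrite summxE.
by apply: bmeas_sum => k; exact: bf.
Qed.

Lemma vint_sum n b (r : seq nat) (f : nat -> R -> 'cV[R]_n) :
  (forall k i, bmeas `[0, b] (fun s => f k s i 0)) ->
  vint b (fun s => \sum_(k <- r) f k s) = \sum_(k <- r) vint b (f k).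
Proof.
move=> bf; apply/colP => i; rewrite summxE mxE.
under eq_Rintegral do rewrite summxE.
rewrite Rintegral_sum; last by move=> k; exact: bf.
by apply: eq_bigr => k _; rewrite mxE.
Qed.

Definition admissible n m (G : 'M[R]_(n, m)) (u : R -> 'cV[R]_n) : Prop :=
  (forall i, measurable_fun [set: R] (fun s => u s i 0)) /\
  forall s, zonotope 0 G (u s).

Lemma admissible_bmeas n m (G : 'M[R]_(n, m)) u (D : set R) i :
  admissible G u -> bmeas D (fun s => u s i 0).
Proof.
by move=> [mu_ Gu]; split=> //; exists (\sum_j `|G i j|) => s _; exact: zonotope0_bound.
Qed.

(** A weighted mean stays in a closed convex set: if [p] is the projection of
    the mean [x], integrating the separation inequality satisfied by the values
    of [u] yields the inequality at [x] itself, that is [|x - p|^2 <= 0]. *)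
Lemma zonotope_mean n m (G : 'M[R]_(n, m)) (w : R -> R) u b :
  bmeas `[0, b] w -> (forall s, 0 <= s <= b -> 0 <= w s) ->
  0 < \int[mu]_(s in `[0, b]) w s -> admissible G u ->
  exists2 v, zonotope 0 G v &
    vint b (fun s => w s *: u s) = (\int[mu]_(s in `[0, b]) w s) *: v.
Proof.
move=> bw w0 W0 adu; set W := Rintegral _ _ _ in W0 *.
have bu i : bmeas `[0, b] (fun s => u s i 0) by exact: admissible_bmeas adu.
pose x := W^-1 *: vint b (fun s => w s *: u s).
have xE : vint b (fun s => w s *: u s) = W *: x.
  by rewrite scalerA divff ?gt_eqF ?scale1r.
have [p Zp px] := zonotope_projection 0 G x.
suff xp : x = p by exists p; rewrite // xE xp.
apply/eqP; rewrite -subr_eq0; apply/eqP; apply: dotvv_eq0.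
have bup i : bmeas `[0, b] (fun s => (u s - p) i 0).
  rewrite (_ : (fun _ => _) = fun s => u s i 0 + - p i 0).
    by apply: bmeasD => //; exact: bmeas_cst.
  by apply/funext => s; rewrite !mxE.
pose f s := w s * dotv (x - p) (u s - p).
have fE : \int[mu]_(s in `[0, b]) f s = W * dotv (x - p) (x - p).
  rewrite /f /dotv; under eq_Rintegral do rewrite mulr_sumr.
  rewrite Rintegral_sum; last first.
    by move=> i; apply: bmeasM => //; apply: bmeasM => //; exact: bmeas_cst.
  rewrite mulr_sumr; apply: eq_bigr => i _.
  have bwu : bmeas `[0, b] (fun s => w s * u s i 0) by exact: bmeasM.
  under eq_Rintegral => s _.
    rewrite (_ : _ * _ = (x - p) i 0 * (w s * u s i 0) +
                         (- ((x - p) i 0 * p i 0)) * w s); last first.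
      by rewrite !mxE; ring.
    over.
  have bc c (g : R -> R) : bmeas `[0, b] g -> bmeas `[0, b] (fun s => c * g s).
    by move=> bg; apply: bmeasM => //; exact: bmeas_cst.
  rewrite RintegralD//; [|exact/bmeas_integrable/bc..].
  rewrite !RintegralZl//; [|exact: bmeas_integrable..].
  have -> : \int[mu]_(s in `[0, b]) (w s * u s i 0) = W * x i 0.
    have := congr1 (fun v : 'cV[R]_n => v i 0) xE; rewrite /vint !mxE => <-.
    by apply: eq_Rintegral => s _; rewrite mxE.
  by rewrite -/W !mxE; ring.
rewrite -(pmulr_rle0 _ W0) -fE -oppr_ge0.
have bf : bmeas `[0, b] f.
  apply: bmeasM => //; apply: bmeas_sum => i; apply: bmeasM => //.
  exact: bmeas_cst.
rewrite -mulN1r -RintegralZl//; last exact: bmeas_integrable.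
apply: Rintegral_ge0 => s /=; rewrite in_itv/= => /w0 ws0.
by rewrite mulN1r oppr_ge0 mulr_ge0_le0//; apply: px; exact: adu.2.
Qed.

End Inputs.

(** * Reachable sets *)

Section ReachableSets.
Context {R : realType} (n m : nat) (A : 'M[R]_n) (G : 'M[R]_(n, m)).
Implicit Types (b c : R) (u : R -> 'cV[R]_n).

Notation P := (particular_solution A (zonotope 0 G)).

Lemma particular_solutionP b x : P b x <->
  exists2 u, admissible G u & x = vint b (fun s => expmx ((b - s) *: A) *m u s).
Proof. by split=> [[u [mu_ Gu ->]]|[u [mu_ Gu] ->]]; exists u. Qed.

Lemma bmeas_response a b c u i : admissible G u ->
  bmeas `[a, b] (fun s => (expmx ((c - s) *: A) *m u s) i 0).
Proof.
move=> adu; apply: bmeas_mulmx => [p q|q]; first exact: bmeas_expmx.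
exact: admissible_bmeas adu.
Qed.

(** The part of the input before time [c] evolves freely for a further time
    [b]; the part after [c] is a response of duration [b] to the shifted
    input. *)
Lemma vint_response_split b c u : 0 <= b -> 0 <= c -> admissible G u ->
  vint (b + c) (fun s => expmx ((b + c - s) *: A) *m u s) =
  vint b (fun s => expmx ((b - s) *: A) *m u (s + c)) +
  expmx (b *: A) *m vint c (fun s => expmx ((c - s) *: A) *m u s).
Proof.
move=> b0 c0 adu.
rewrite vint_mulmx; last by move=> i; exact: bmeas_response.
rewrite [RHS]addrC; apply/colP => i; rewrite 4!mxE.
rewrite (@Rintegral_split _ 0 (b + c) c) ?c0 ?lerDr//; last exact: bmeas_response.
congr (_ + _).
  by apply: eq_Rintegral => s _; rewrite mulmxA -expmxD addrA.
rewrite Rintegral_shift; last exact: bmeas_response.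
by apply: eq_Rintegral => s _; rewrite opprD addrACA subrr addr0.
Qed.

Lemma admissible_shift c u : admissible G u -> admissible G (fun s => u (s + c)).
Proof.
move=> [mu_ Gu]; split=> // i; apply: (measurableT_comp (mu_ i)).
exact: measurable_funD.
Qed.

Lemma admissible_concat c u v : admissible G u -> admissible G v ->
  admissible G (fun s => if s <= c then u s else v (s - c)).
Proof.
move=> [mu_ Gu] [mv Gv]; split=> [i|s]; last by case: ifP.
rewrite (_ : (fun _ => _) =
  fun s => if s <= c then u s i 0 else v (s - c) i 0); last first.
  by apply/funext => s; case: ifP.
apply: measurable_fun_ifT => //.
  exact: measurable_fun_ler.
by apply: (measurableT_comp (mv i)); exact: measurable_funB.
Qed.

(** The exact reachable sets obey the recursion that defines the outer
    approximations: inputs can be both cut and concatenated at time [c]. *)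
Lemma particular_solutionD b c : 0 <= b -> 0 <= c ->
  P (b + c) = minkowski_sum (P b) (mximage (expmx (b *: A)) (P c)).
Proof.
move=> b0 c0; apply/seteqP; split=> [x|_ [y Py [_ [z Pz <-] <-]]].
  move=> /particular_solutionP[u adu ->]; rewrite vint_response_split//.
  eexists; [|eexists; [|reflexivity]].
    apply/particular_solutionP; exists (fun s => u (s + c)) => //.
    exact: admissible_shift.
  by eexists; [|reflexivity]; apply/particular_solutionP; exists u.
move: Py Pz => /particular_solutionP[u adu ->] /particular_solutionP[v adv ->].
(* The input that acts first is the one whose response is propagated. *)
have adw := admissible_concat c adv adu.
apply/particular_solutionP; exists (fun s => if s <= c then v s else u (s - c)) => //.
rewrite vint_response_split//; congr (_ + _); last congr (_ *m _).
  apply: eq_vint_oc.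
  - by move=> i; exact: bmeas_response.
  - by move=> i; exact: bmeas_response (admissible_shift c adw).
  - by move=> s /andP[s0 _]; rewrite addrK leNgt ltrDr s0.
by apply: eq_vint => s /andP[_ ->].
Qed.

Lemma particular_solution_0 b : P b 0.
Proof.
apply/particular_solutionP; exists (fun=> 0).
  by split=> [i|s]; [under eq_fun do rewrite mxE; exact: measurable_cst|exact: zonotope0_0].
apply/colP => i; rewrite !mxE; under eq_Rintegral do rewrite mulmx0 mxE.
by rewrite Rintegral_cst// mul0r.
Qed.

Lemma particular_solution_at0 : P 0 = [set 0].
Proof.
apply/seteqP; split=> [x /particular_solutionP[u _ ->]|_ ->].
  apply/colP => i; rewrite !mxE set_itv1.
  exact: Rintegral_set1.
exact: particular_solution_0.
Qed.

(** Applying the zero input first delays any response. *)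
Lemma particular_solution_mono b c : 0 <= b -> b <= c -> P b `<=` P c.
Proof.
move=> b0 bc x Px; rewrite -(subrKC b c) particular_solutionD ?subr_ge0//.
exists x => //; exists 0; last by rewrite addr0.
by exists 0; [exact: particular_solution_0|rewrite mulmx0].
Qed.

(** Where [d] vanishes so does [x], and the convention [x / 0 = 0] then gives an
    admissible coefficient. *)
Lemma zonotope_diag (d : 'rV[R]_n) (x : 'cV[R]_n) :
  (forall i, `|x i 0| <= d 0 i) -> zonotope 0 (diag_mx d) x.
Proof.
move=> xd; exists (\col_i (x i 0 / d 0 i)).
  move=> j /=; rewrite mxE -ler_norml normrM normfV.
  have d0 : 0 <= d 0 j by apply: le_trans (xd j).
  have [->|dn0] := eqVneq (d 0 j) 0; first by rewrite normr0 invr0 mulr0 ler01.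
  by rewrite (ger0_norm d0) ler_pdivrMr ?mul1r// lt0r dn0.
rewrite add0r; apply/colP => i; rewrite mul_diag_mx !mxE.
have [d0|dn0] := eqVneq (d 0 i) 0; last by rewrite mulrC divfK.
by have := xd i; rewrite d0 normr_le0 => /eqP ->; rewrite mul0r.
Qed.

Lemma remainder_setP b eta (x : 'cV[R]_n) :
  (forall i, `|x i 0| <=
    b * \sum_j (exp_remainder A b eta i j * \sum_l `|G j l|)) ->
  remainder_set A G b eta x.
Proof.
move=> xb; apply: zonotope_diag => i; apply: le_trans (xb i) _.
rewrite !mxE mulr_sumr le_eqVlt; apply/orP; left; apply/eqP.
apply: eq_bigr => j _; rewrite !mxE normr0 add0r summxE mulrA; congr (_ * _).
by apply: eq_bigr => l _; rewrite !mxE.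
Qed.

(** Integrates the Taylor expansion of the kernel term by term. The tail is at
    most [exp_remainder A b eta] throughout the step and the coordinates of the
    input are at most the row sums of [|G|], so the integral of the tail falls
    in the remainder box. *)
Lemma response_expansion b eta u : 0 <= b -> admissible G u ->
  exists2 r, remainder_set A G b eta r &
    vint b (fun s => expmx ((b - s) *: A) *m u s) =
    \sum_(0 <= i < eta.+1)
      A ^+ i *m vint b (fun s => exp_coeff (b - s) i *: u s) + r.
Proof.
move=> b0 adu.
have bu j : bmeas `[0, b] (fun s => u s j 0) by exact: admissible_bmeas adu.
have bZ k j : bmeas `[0, b] (fun s => (exp_coeff (b - s) k *: u s) j 0).
  rewrite (_ : (fun _ => _) = fun s => exp_coeff (b - s) k * u s j 0).
    by apply: bmeasM => //; exact: bmeas_exp_coeff.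
  by apply/funext => s; rewrite mxE.
have bT j : bmeas `[0, b] (fun s => (expmx_tail ((b - s) *: A) eta *m u s) j 0).
  by apply: bmeas_mulmx => // p q; exact: bmeas_expmx_tail.
have bAZ k j : bmeas `[0, b] (fun s => (A ^+ k *m (exp_coeff (b - s) k *: u s)) j 0).
  by apply: bmeas_mulmx => // p q; exact: bmeas_cst.
exists (vint b (fun s => expmx_tail ((b - s) *: A) eta *m u s)).
  apply: remainder_setP => i; rewrite mxE.
  apply: normr_Rintegral_le => // s /andP[s0 sb].
  rewrite mxE; apply: le_trans (ler_norm_sum _ _ _) _; apply: ler_sum => j _.
  rewrite normrM ler_pM// ?(zonotope0_bound _ (adu.2 s))//.
  by apply: normr_expmx_tail; rewrite ger0_norm ?subr_ge0// lerBlDr lerDl.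
under eq_bigr do rewrite vint_mulmx//.
rewrite -vint_sum// -vintD//; last by apply: bmeas_vsum.
apply: eq_vint => s _; rewrite /expmx_tail mulmxBl mulmx_suml addrCA -sumrB.
rewrite big1 ?addr0// => k _.
by rewrite expmx_coeffZ -scalemxAl -scalemxAr subrr.
Qed.

Lemma big_minkowski_sumP (r : seq nat) (F : nat -> set 'cV[R]_n) (f : nat -> 'cV[R]_n) :
  (forall i, F i (f i)) ->
  (\big[@minkowski_sum R n/[set 0]]_(i <- r) F i) (\sum_(i <- r) f i).
Proof.
move=> Ff; elim: r => [|i r IH]; first by rewrite !big_nil.
by rewrite !big_cons; exists (f i) => //; exists (\sum_(j <- r) f j).
Qed.

Lemma taylor_intE b i : taylor_int A b i = exp_coeff b i.+1 *: A ^+ i.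
Proof. by []. Qed.

(** The Taylor weights [(b - s)^i / i!] are nonnegative with integral
    [b^(i+1) / (i+1)!]: by convexity each term of the expansion is a Taylor
    matrix applied to some point of the zonotope. *)
Lemma particular_solution_step b eta : 0 < b -> P b `<=` step_approx A G b eta.
Proof.
move=> b0 x /particular_solutionP[u adu ->].
have [r rR ->] := response_expansion eta (ltW b0) adu.
eexists; [|eexists; [exact: rR|reflexivity]].
apply: big_minkowski_sumP => i.
have W : \int[lebesgue_measure]_(s in `[0, b]) exp_coeff (b - s) i = exp_coeff b i.+1.
  exact: Rintegral_exp_coeff.
have [||v Gv ->] := zonotope_mean (bmeas_exp_coeff 0 b b i) _ _ adu.
- by move=> s /andP[_ sb]; rewrite exp_coeff_ge0// subr_ge0.
- by rewrite W /exp_coeff/= divr_gt0 ?exprn_gt0// ltr0n fact_gt0.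
by exists v => //; rewrite W taylor_intE -scalemxAl -scalemxAr.
Qed.

(** For a constant input all the weighted means of the expansion coincide, so
    the Taylor matrices are summed before being applied. *)
Lemma constant_input_response b eta w : 0 < b -> zonotope 0 G w ->
  exists2 r, remainder_set A G b eta r &
    P b (\sum_(0 <= i < eta.+1) taylor_int A b i *m w + r).
Proof.
move=> b0 Gw.
have adw : admissible G (fun=> w) by split.
have [r rR H] := response_expansion eta (ltW b0) adw.
exists r => //; apply/particular_solutionP; exists (fun=> w) => //.
rewrite H; congr (_ + _); apply: eq_bigr => i _.
rewrite taylor_intE -scalemxAl scalemxAr; congr (_ *m _).
apply/colP => j; rewrite !mxE; under eq_Rintegral do rewrite mxE.
rewrite RintegralZr//; last exact: bmeas_integrable (bmeas_exp_coeff _ _ _ _).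
by rewrite Rintegral_exp_coeff.
Qed.

End ReachableSets.
(** * Hausdorff distance and the error functional *)

Section Distances.
Context {R : realType}.

Lemma err_ge0 n (S : set 'cV[R]_n) : (0 <= err S)%E.
Proof. by apply: le_ereal_inf_tmp => _ [r [r0 _] <-]; rewrite lee_fin. Qed.

Lemma enorm_le_err n (S : set 'cV[R]_n) x : S x -> ((enorm x)%:E <= err S)%E.
Proof.
move=> Sx; apply: le_ereal_inf_tmp => _ [r [_ Sr] <-]; rewrite lee_fin.
by apply: Sr; exact: (sub_gen_smallest Sx).
Qed.

Lemma hausdorff_le n (S T : set 'cV[R]_n) (e : \bar R) :
  S `<=` T -> (0 <= e)%E ->
  (forall y, T y -> exists2 x, S x & ((enorm (x - y))%:E <= e)%E) ->
  (hausdorff S T <= e)%E.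
Proof.
move=> ST e0 TS; rewrite /hausdorff ge_max; apply/andP; split.
  apply: ge_ereal_sup => _ [x Sx <-]; apply: ge_ereal_inf.
  exists (enorm (x - x))%:E; first by exists x => //; exact: ST.
  by rewrite subrr enorm0.
apply: ge_ereal_sup => _ [y /TS[x Sx xy] <-]; apply: ge_ereal_inf.
by exists (enorm (x - y))%:E => //; exists x.
Qed.

(** The points of the inner set are at distance 0 from [T], and a larger inner
    set comes closer to the points of [T]. *)
Lemma hausdorff_antimono n (S S' T : set 'cV[R]_n) :
  S !=set0 -> S `<=` S' -> S' `<=` T -> (hausdorff S' T <= hausdorff S T)%E.
Proof.
move=> [z Sz] SS' S'T; rewrite {1}/hausdorff ge_max; apply/andP; split.
  apply: (@le_trans _ _ 0%E).
    apply: ge_ereal_sup => _ [x Sx <-]; apply: ge_ereal_inf.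
    exists (enorm (x - x))%:E; first by exists x => //; exact: S'T.
    by rewrite subrr enorm0.
  rewrite /hausdorff le_max; apply/orP; left; apply: le_ereal_sup_tmp.
  eexists; first by exists z.
  by apply: le_ereal_inf_tmp => _ [y _ <-]; rewrite lee_fin enorm_ge0.
rewrite /hausdorff le_max; apply/orP; right.
apply: ge_ereal_sup => _ [y Ty <-]; apply: le_ereal_sup_tmp.
eexists; first by exists y.
by apply: ereal_inf_le_tmp => _ [x Sx <-]; exists x => //; exact: SS'.
Qed.

End Distances.

(** * The recursion *)

Section Recursion.
Context {R : realType} (n m : nat) (A : 'M[R]_n) (G : 'M[R]_(n, m)).
Context (t : nat -> R) (eta : nat -> nat).
Context (t0 : t 0%N = 0) (t_incr : forall k, t k < t k.+1).

Notation P := (particular_solution A (zonotope 0 G)).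
Notation reach := (reach_approx A G t eta).

Lemma time_ge0 k : 0 <= t k.
Proof. by elim: k => [|k /le_trans]; [rewrite t0|apply; exact: ltW]. Qed.

Lemma particular_solution_recursion k :
  P (t k.+1) =
  minkowski_sum (P (t k)) (mximage (expmx (t k *: A)) (P (t k.+1 - t k))).
Proof.
rewrite -particular_solutionD ?subrKC//; first exact: time_ge0.
by rewrite subr_ge0 ltW.
Qed.

Lemma particular_solution_sub_reach k : P (t k) `<=` reach k.
Proof.
elim: k => [|k IH]; first by rewrite t0 particular_solution_at0.
rewrite particular_solution_recursion => _ [x Px [_ [z Pz <-] <-]].
exists x; first exact: IH.
eexists; last reflexivity; exists z => //.
by apply: particular_solution_step Pz; rewrite subr_gt0.
Qed.

Lemma total_error_ge0 k : (0 <= total_error A G t eta k)%E.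
Proof. by elim: k => //= k IH; rewrite !adde_ge0// err_ge0. Qed.

(** A point [z] of the step set uses an input vector of its own for each Taylor
    term. It is compared with the response to the constant input [w] used in
    its term of order 0: these terms cancel and leave a point of the set with
    summed matrices minus a point of the set with summed images, the two sets
    measured by [step_error]. *)
Lemma step_cover k z : step_approx A G (t k.+1 - t k) (eta k) z ->
  exists2 x, P (t k.+1 - t k) x &
    ((enorm (expmx (t k *: A) *m (x - z)))%:E <= step_error A G t eta k)%E.
Proof.
set dt := t k.+1 - t k; have dt0 : 0 < dt by rewrite subr_gt0.
rewrite /step_approx big_ltn// => -[_ [_ [w Gw <-] [z' z'P <-]]] [e eP <-].
have [r rP xP] := constant_input_response A (eta k) dt0 Gw.
eexists; first exact: xP.
rewrite big_ltn// -mulmx_suml.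
set M := expmx _; set S1 := \sum_(1 <= i < _) _.
have -> : M *m (taylor_int A dt 0 *m w + S1 *m w + r -
    (taylor_int A dt 0 *m w + z' + e)) = M *m (S1 *m w + r) - M *m (z' + e).
  rewrite -mulmxBr; congr (_ *m _).
  by rewrite -(addrA _ (S1 *m w)) -(addrA _ z') [_ + (S1 *m w + r)]addrC addrKA.
apply: (@le_trans _ _ ((enorm (M *m (S1 *m w + r)))%:E + (enorm (M *m (z' + e)))%:E)%E).
  by rewrite -EFinD lee_fin -[X in _ <= _ + X]enormN enormD.
apply: leeD; apply: enorm_le_err; eexists; try reflexivity.
  by exists (S1 *m w); [exists w|exists r].
by exists z' => //; exists e.
Qed.

(** Exact sets and approximations obey the same recursion, so the errors of the
    steps add up by the triangle inequality. *)
Lemma reach_cover k y : reach k y ->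
  exists2 x, P (t k) x & ((enorm (x - y))%:E <= total_error A G t eta k)%E.
Proof.
elim: k y => [|k IH] y /=.
  move=> ->; exists 0; first exact: particular_solution_0.
  by rewrite subr0 enorm0.
move=> [y' /IH[x Px xy'] [_ [z /step_cover[x' Px' x'z] <-] <-]].
exists (x + expmx (t k *: A) *m x').
  rewrite particular_solution_recursion; exists x => //.
  by exists (expmx (t k *: A) *m x') => //; exists x'.
rewrite opprD addrACA -mulmxBr.
apply: le_trans (leeD xy' x'z); rewrite -EFinD lee_fin; exact: enormD.
Qed.

End Recursion.

Theorem proposition3 (R : realType) (n m : nat)
    (A : 'M[R]_n) (G0 : 'M[R]_(n, m))
    (t : nat -> R) (eta : nat -> nat)
    (t0 : t 0%N = 0) (t_incr : forall k : nat, t k < t k.+1)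
    (eta_gt0 : forall k : nat, (0 < eta k)%N) (k : nat) :
  (forall s : R, t k <= s <= t k.+1 ->
     particular_solution A (zonotope 0 G0) s
       `<=` reach_approx A G0 t eta k.+1) /\
  (exists s_max : R,
     [/\ t k <= s_max <= t k.+1,
         forall s : R, t k <= s <= t k.+1 ->
           (hausdorff (particular_solution A (zonotope 0 G0) s)
                      (reach_approx A G0 t eta k.+1)
            <= hausdorff (particular_solution A (zonotope 0 G0) s_max)
                         (reach_approx A G0 t eta k.+1))%E
       & (hausdorff (particular_solution A (zonotope 0 G0) s_max)
                    (reach_approx A G0 t eta k.+1)
          <= total_error A G0 t eta k + interval_error A G0 t eta k)%E]).
Proof.
have tk0 := time_ge0 t0 t_incr k.
have sub s : t k <= s <= t k.+1 ->
    particular_solution A (zonotope 0 G0) s `<=` reach_approx A G0 t eta k.+1.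
  move=> /andP[ts st].
  apply: subset_trans (@particular_solution_sub_reach R n m A G0 t eta t0 t_incr k.+1).
  by apply: particular_solution_mono => //; exact: le_trans ts.
have tkk : t k <= t k <= t k.+1 by rewrite lexx ltW.
split; first exact: sub.
exists (t k); split; [exact: tkk|move=> s /[dup] sk /andP[ts _]|].
  apply: hausdorff_antimono; [|exact: particular_solution_mono|exact: (sub s sk)].
  by exists 0; exact: particular_solution_0.
apply: hausdorff_le; first exact: (sub _ tkk).
  by rewrite adde_ge0 ?total_error_ge0 ?err_ge0.
move=> y [y' /(reach_cover t0 t_incr)[x Px xy'] [_ [z zP <-] <-]].
exists x; first exact: Px.
rewrite opprD addrA.
apply: (@le_trans _ _ ((enorm (x - y'))%:E + (enorm (expmx (t k *: A) *m z))%:E)%E).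
  by rewrite -EFinD lee_fin -[X in _ <= _ + X]enormN enormD.
by apply: leeD; [exact: xy'|]; apply: enorm_le_err; exists z.
Qed.
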